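(* For any positive integer $n$, $$\sum_{k=0}^{n} S_B(n,k)\, C_k^B = \frac{1}{n+1} = \sum_{k=0}^{n} S_B(n,k)\,(-1)^{n-k}\, c_k^B .$$
   Context: The type $B$ falling factorial is $(x)_n^B = (x-1)(x-3)(x-5)\cdots(x-2n+1)$ for $n\ge 1$, with $(x)_0^B = 1$. The type $B$ rising factorial is $[x]_n^B = (x+1)(x+3)(x+5)\cdots(x+2n-1)$ for $n\ge 1$, with $[x]_0^B = 1$. The type $B$ Cauchy numbers of the first kind are $C_n^B = \int_0^1 (x)_n^B\,dx$, and those of the second kind are $c_n^B = \int_0^1 [x]_n^B\,dx$, for $n \ge 0$. The type $B$ Stirling numbers of the second kind $S_B(n,k)$, $0\le k\le n$, are defined by $S_B(n,n)=S_B(n,0)=1$ for all $n\ge 0$ and $S_B(n,k)=S_B(n-1,k-1)+(2k+1)S_B(n-1,k)$ for $1\le k<n$. *)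

(* Defs.v *)
From Stdlib Require Import Reals Arith Lia.
From Coquelicot Require Import Coquelicot.
Open Scope R_scope.

(* (x)_n^B = (x-1)(x-3)...(x-2n+1) *)
Fixpoint falling_B (x : R) (n : nat) : R :=
  match n with
  | O => 1
  | S m => falling_B x m * (x - INR (2 * m + 1))
  end.

(* [x]_n^B = (x+1)(x+3)...(x+2n-1) *)
Fixpoint rising_B (x : R) (n : nat) : R :=
  match n with
  | O => 1
  | S m => rising_B x m * (x + INR (2 * m + 1))
  end.

Definition cauchy1_B (n : nat) : R := RInt (fun x => falling_B x n) 0 1.

Definition cauchy2_B (n : nat) : R := RInt (fun x => rising_B x n) 0 1.

(* Extended by 0 to k > n; the defining equations on 0 <= k <= n are
   [stirling2_B_diag], [stirling2_B_0] and [stirling2_B_rec] below. *)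
Fixpoint stirling2_B (n k : nat) : nat :=
  match n, k with
  | _, O => 1
  | O, S _ => 0
  | S n', S k' => stirling2_B n' k' + (2 * k + 1) * stirling2_B n' k
  end.

Lemma stirling2_B_0 (n : nat) : stirling2_B n 0 = 1%nat.
Proof. now destruct n. Qed.

Lemma stirling2_B_gt (n k : nat) : (n < k)%nat -> stirling2_B n k = 0%nat.
Proof.
revert k; induction n as [|n IH]; intros [|k] H; try lia; [reflexivity|].
cbn [stirling2_B]; rewrite (IH k), (IH (S k)) by lia; lia.
Qed.

Lemma stirling2_B_diag (n : nat) : stirling2_B n n = 1%nat.
Proof.
induction n as [|n IH]; [reflexivity|].
cbn [stirling2_B]; rewrite IH, stirling2_B_gt by lia; lia.
Qed.

Lemma stirling2_B_rec (n k : nat) : (1 <= k < n)%nat ->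
  stirling2_B n k =
  (stirling2_B (n - 1) (k - 1) + (2 * k + 1) * stirling2_B (n - 1) k)%nat.
Proof.
intros H; destruct n as [|n]; [lia|]; destruct k as [|k]; [lia|].
now replace (S n - 1)%nat with n by lia; replace (S k - 1)%nat with k by lia.
Qed.

(* Main.v *)
Require Import Defs.
From Stdlib Require Import Reals Lra Lia.
From Coquelicot Require Import Coquelicot.
Open Scope R_scope.

(** The type B Stirling numbers are the coefficients that expand a power in
    the basis of type B factorials:
    [x ^ n = sum_k S_B(n,k) (x)_k], and, after replacing [x] by [-x],
    [x ^ n = sum_k (-1)^(n-k) S_B(n,k) [x]_k].
    Integrating either expansion term by term over the unit interval turns the
    factorials into Cauchy numbers and the power into [1/(n+1)].

    Both expansions are instances of [pow_stirling2_B], which uses only the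
    relation [y F_k = F_(k+1) + (2k+1) F_k]; it holds at [y = x] for the falling
    factorials and at [y = -x] for the rising ones with alternating signs.
    The integration step is [sum_RInt_of_pow_expansion]. *)

(** Multiplication by [y] acts on the sequence [F] by the recurrence of
    [stirling2_B], so the expansion propagates from [y ^ n] to [y ^ (n + 1)]. *)
Lemma pow_stirling2_B (y : R) (F : nat -> R) :
  F O = 1 ->
  (forall k, y * F k = F (S k) + INR (2 * k + 1) * F k) ->
  forall n, y ^ n = sum_f_R0 (fun k => INR (stirling2_B n k) * F k) n.
Proof.
intros F0 FS n; induction n as [|n IH]; [simpl; lra|].
rewrite <- tech_pow_Rmult, IH, scal_sum.
rewrite (sum_eq _ (fun k => INR (stirling2_B n k) * F (S k) +
  INR (stirling2_B n k) * INR (2 * k + 1) * F k)).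
2: { intros k _; rewrite Rmult_assoc, (Rmult_comm (F k) y), FS; ring. }
rewrite sum_plus.
(* The weighted sum may be run up to [S n], its last Stirling number being 0;
   its terms then line up with those of the expansion of [y ^ S n]. *)
assert (E : sum_f_R0 (fun k => INR (stirling2_B n k) * INR (2 * k + 1) * F k) n
  = sum_f_R0 (fun k => INR (stirling2_B n k) * INR (2 * k + 1) * F k) (S n)).
{ rewrite tech5, (stirling2_B_gt n (S n)) by lia; simpl; ring. }
rewrite E, 2!(decomp_sum _ (S n)) by lia.
rewrite 2!stirling2_B_0, F0; simpl pred.
match goal with |- ?p + (?a + ?q) = ?b + ?s =>
  enough (H : p + q = s) by (rewrite <- H; simpl; ring) end.
rewrite <- sum_plus.
apply sum_eq; intros k _; cbn [stirling2_B].
rewrite (plus_INR (stirling2_B n k)), (mult_INR _ (stirling2_B n (S k))); ring.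
Qed.

Lemma pow_falling_B (x : R) (n : nat) :
  x ^ n = sum_f_R0 (fun k => INR (stirling2_B n k) * falling_B x k) n.
Proof.
apply pow_stirling2_B; [reflexivity|].
intros k; cbn [falling_B]; ring.
Qed.

Lemma pow_rising_B (x : R) (n : nat) :
  x ^ n =
  sum_f_R0 (fun k => INR (stirling2_B n k) * (-1) ^ (n - k) * rising_B x k) n.
Proof.
replace (x ^ n) with ((- x) ^ n * (-1) ^ n)
  by (rewrite <- Rpow_mult_distr; f_equal; ring).
rewrite (pow_stirling2_B (- x) (fun k => (-1) ^ k * rising_B x k)).
- rewrite Rmult_comm, scal_sum; apply sum_eq; intros k Hk.
  (* Since [n = (n - k) + k], the two factors [(-1) ^ k] cancel. *)
  replace ((-1) ^ n) with ((-1) ^ (n - k) * (-1) ^ k)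
    by (rewrite <- pow_add; f_equal; lia).
  assert (Hs : (-1) ^ k * (-1) ^ k = 1)
    by (rewrite <- Rpow_mult_distr, <- (pow1 k); f_equal; ring).
  transitivity (INR (stirling2_B n k) * (-1) ^ (n - k) * rising_B x k *
    ((-1) ^ k * (-1) ^ k)); [ring|rewrite Hs; ring].
- simpl; ring.
- intros k; cbn [rising_B pow]; ring.
Qed.

Lemma ex_derive_falling_B (n : nat) (x : R) : ex_derive (fun t => falling_B t n) x.
Proof.
induction n as [|n IH]; cbn [falling_B].
- apply ex_derive_const.
- apply (ex_derive_mult (fun t => falling_B t n)); [exact IH|now auto_derive].
Qed.

Lemma ex_derive_rising_B (n : nat) (x : R) : ex_derive (fun t => rising_B t n) x.
Proof.
induction n as [|n IH]; cbn [rising_B].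
- apply ex_derive_const.
- apply (ex_derive_mult (fun t => rising_B t n)); [exact IH|now auto_derive].
Qed.

Lemma is_RInt_sum_f_R0 (c : nat -> R) (F : nat -> R -> R) (a b : R) (n : nat) :
  (forall k, ex_RInt (F k) a b) ->
  is_RInt (fun x => sum_f_R0 (fun k => c k * F k x) n) a b
    (sum_f_R0 (fun k => c k * RInt (F k) a b) n).
Proof.
intros HF.
assert (H : forall k, is_RInt (fun x => c k * F k x) a b (c k * RInt (F k) a b)).
{ intros k; apply (is_RInt_scal (F k)), (RInt_correct (F k)), HF. }
induction n as [|n IH]; simpl; [apply H|].
now apply (is_RInt_plus (V := R_NormedModule)).
Qed.

Lemma RInt_pow_0_1 (n : nat) : RInt (fun x => x ^ n) 0 1 = 1 / (INR n + 1).
Proof.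
assert (Hn : INR n + 1 <> 0) by (pose proof (pos_INR n); lra).
apply is_RInt_unique.
replace (1 / (INR n + 1)) with
  (minus (1 ^ S n / (INR n + 1)) (0 ^ S n / (INR n + 1))).
- apply (is_RInt_derive (fun x => x ^ S n / (INR n + 1))).
  + intros x _; auto_derive; [easy|].
    change (pred (S n)) with n; rewrite ?S_INR.
    destruct n; simpl in *; field; exact Hn.
  + intros x _; apply (ex_derive_continuous (fun x => x ^ n)); now auto_derive.
- unfold minus, plus, opp; simpl; rewrite pow1; field; exact Hn.
Qed.

Lemma sum_RInt_of_pow_expansion (c : nat -> R) (F : nat -> R -> R) (n : nat) :
  (forall k x, ex_derive (F k) x) ->
  (forall x, x ^ n = sum_f_R0 (fun k => c k * F k x) n) ->
  sum_f_R0 (fun k => c k * RInt (F k) 0 1) n = 1 / (INR n + 1).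
Proof.
intros HF HE; rewrite <- RInt_pow_0_1; symmetry; apply is_RInt_unique.
apply is_RInt_ext with (fun x => sum_f_R0 (fun k => c k * F k x) n).
- intros x _; now rewrite HE.
- apply is_RInt_sum_f_R0; intros k.
  apply (ex_RInt_continuous (F k)); intros x _.
  apply (ex_derive_continuous (F k)), HF.
Qed.

Theorem theorem2p5 (n : nat) (hn : (0 < n)%nat) :
  sum_f_R0 (fun k => INR (stirling2_B n k) * cauchy1_B k) n = 1 / (INR n + 1) /\
  1 / (INR n + 1) =
    sum_f_R0 (fun k => INR (stirling2_B n k) * (-1) ^ (n - k) * cauchy2_B k) n.
Proof.
split; [|symmetry].
- apply (sum_RInt_of_pow_expansion (fun k => INR (stirling2_B n k))
    (fun k x => falling_B x k)).
  + exact ex_derive_falling_B.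
  + intros x; apply pow_falling_B.
- apply (sum_RInt_of_pow_expansion
    (fun k => INR (stirling2_B n k) * (-1) ^ (n - k)) (fun k x => rising_B x k)).
  + exact ex_derive_rising_B.
  + intros x; apply pow_rising_B.
Qed.
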